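(* Let $(V,\mu)$ be a positive measure space, let $K_1,\ldots,K_N\in L^2(V,\mu)$, let $g=(g_1,\ldots,g_N)\in\mathbb R^N$, and let $p_1,\ldots,p_N\in[0,1]$. Let $\varepsilon_1,\ldots,\varepsilon_N$ be independent Bernoulli random variables with $\mathbb P(\varepsilon_j=1)=p_j$ and $\mathbb P(\varepsilon_j=0)=1-p_j$, and let $\mathcal E=\sum_{j=1}^N\varepsilon_jg_jK_j$. Then \[ \mathbb E\|\mathcal E\|_2^2=\left\|\sum_{j=1}^N p_jg_jK_j\right\|_2^2+\sum_{j=1}^N p_j(1-p_j)|g_j|^2\|K_j\|_2^2 . \]
   Context: $\|\cdot\|_2$ is the norm of $L^2(V,\mu)$. $\mathcal E$ is a random element of $L^2(V,\mu)$, and $\mathbb E$ is expectation with respect to the $\varepsilon_j$. *)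

(* Defs.v *)
From HB Require Import structures.
From mathcomp Require Import all_boot all_order all_algebra.
From mathcomp Require Import all_classical all_reals all_analysis.

Set Implicit Arguments.
Unset Strict Implicit.
Unset Printing Implicit Defensive.
Import Order.TTheory GRing.Theory Num.Theory.
Import numFieldNormedType.Exports.
Local Open Scope classical_set_scope.
Local Open Scope ring_scope.

(* Elements of L^2(V, mu) are given by representatives: real-valued measurable
   functions with finite L^2-norm, which form an R-module. The quotient
   [LspaceType2] carries no module structure, and everything below depends only
   on the a.e.-classes. *)
Notation L2 mu := (LfunType mu (lee1n 2)).

(* [fine] loses nothing here: the norm is finite by [Lfunction_finite]. *)
Definition L2norm (d : measure_display) (V : measurableType d) (R : realType)
    (mu : {measure set V -> \bar R}) (f : L2 mu) : R :=
  fine 'N[mu]_2%:E[EFin \o f].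

Definition mutually_independent (d : measure_display) (Omega : measurableType d)
    (R : realType) (P : probability Omega R) (I : finType)
    (X : I -> {RV P >-> R}) : Prop :=
  forall (J : {set I}) (B : I -> set R),
    (forall i, i \in J -> measurable (B i)) ->
    P (\bigcap_(i in [set` J]) (X i @^-1` B i)) =
    (\prod_(i in J) P (X i @^-1` B i))%E.

Definition is_bernoulli (d : measure_display) (Omega : measurableType d)
    (R : realType) (P : probability Omega R) (p : R) (X : {RV P >-> R}) : Prop :=
  P (X @^-1` [set 1]) = p%:E /\ P (X @^-1` [set 0]) = (1 - p)%:E.

(* Main.v *)
(* Expanding the square, [||sum_j a_j K_j||^2] is the quadratic form
   [sum_(i, j) a_i a_j <K_i, K_j>]. With [a_j = eps_j g_j], its expectation only
   involves [E (eps_i eps_j)], which is [p_i p_j] off the diagonal by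
   independence and [p_i = p_i^2 + p_i (1 - p_i)] on it. The law only fixes
   [eps_j] almost everywhere, so it is first replaced by the indicator of
   [{eps_j = 1}]. *)
Require Import Defs.
From HB Require Import structures.
From mathcomp Require Import all_boot all_order all_algebra.
From mathcomp Require Import all_classical all_reals all_analysis.
From mathcomp Require Import measurable_realfun ring.
Import Order.TTheory GRing.Theory Num.Theory.
Import numFieldNormedType.Exports.
Local Open Scope classical_set_scope.
Local Open Scope ring_scope.

Section integral_lincomb.
Context {d : measure_display} {T : measurableType d} {R : realType}.
Variable mu : {measure set T -> \bar R}.

(** Serves twice: over [V] to expand the squared norm, and over [Omega] to take its expectation. *)
Lemma integral_lincomb (I : finType) (c : I -> R) (F : I -> T -> R) :
  (forall i, mu.-integrable setT (EFin \o F i)) ->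
  (\int[mu]_x (\sum_i c i * F i x)%:E)%E =
  (\sum_i c i * \int[mu]_x F i x)%:E.
Proof.
move=> intF; under eq_integral do rewrite -sumEFin.
rewrite integral_sum//.
  rewrite -sumEFin; apply: eq_bigr => i _.
  under eq_integral do rewrite EFinM.
  rewrite integralZl//; last exact: intF.
  rewrite EFinM /Rintegral fineK//.
  exact: integrable_fin_num (intF i).
move=> i; have := integrableZl measurableT (c i) (intF i).
by apply: eq_integrable => // x _ /=; rewrite EFinM.
Qed.

End integral_lincomb.

Section L2_inner_product.
Context {d : measure_display} {V : measurableType d} {R : realType}.
Variable mu : {measure set V -> \bar R}.
Implicit Types f h : L2 mu.

(** The inner product of the real space $L^2(V,\mu)$. The real-valued integral is faithful here, as
    the product of two $L^2$ functions is integrable. *)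
Definition L2dot f h : R := \int[mu]_x (f x * h x).

Lemma integrable_L2dot f h : mu.-integrable setT (EFin \o (fun x => f x * h x)).
Proof. by apply/Lfun1_integrable/Lfun2_mul_Lfun1; exact: LfunP. Qed.

Lemma L2norm_sqr f : L2norm f ^+ 2 = L2dot f f.
Proof.
have nf : ('N[mu]_2%:E[EFin \o f] \is a fin_num)%E.
  by rewrite -finite_norm_fine.
(* Written as a real power with exponent 2, the square cancels the root in the definition of the
   norm. *)
rewrite /L2norm -powR_mulrn ?fine_ge0 ?Lnorm_ge0//.
apply: EFin_inj; rewrite -poweR_EFin fineK// poweR_Lnorm//.
rewrite /L2dot /Rintegral fineK; last first.
  exact: integrable_fin_num (integrable_L2dot f f).
apply: eq_integral => x _ /=.
by rewrite powR_mulrn// real_normK ?num_real// expr2.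
Qed.

Lemma L2_lincombE (I : finType) (a : I -> R) (K : I -> L2 mu) x :
  (\sum_i a i *: K i) x = \sum_i a i * K i x.
Proof.
(* Evaluation goes through [\val], which is additive, so the sum in the module becomes a pointwise
   sum of functions. *)
rewrite -[LHS]/(\val (\sum_i a i *: K i) x) raddf_sum fct_sumE.
by apply: eq_bigr => i _.
Qed.

(** Summing over pairs makes the quadratic form a single linear combination of integrals. *)
Lemma L2norm_lincomb_sqr (I : finType) (a : I -> R) (K : I -> L2 mu) :
  L2norm (\sum_i a i *: K i) ^+ 2 =
  \sum_(ij : I * I) a ij.1 * a ij.2 * L2dot (K ij.1) (K ij.2).
Proof.
rewrite L2norm_sqr; apply: EFin_inj; rewrite -integral_lincomb; last first.
  by move=> ij; exact: integrable_L2dot.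
rewrite /L2dot /Rintegral fineK; last first.
  exact: integrable_fin_num (integrable_L2dot _ _).
apply: eq_integral => x _; congr EFin.
rewrite L2_lincombE big_distrlr/= pair_bigA/=.
by apply: eq_bigr => ij _; rewrite mulrACA.
Qed.

End L2_inner_product.

Section bernoulli.
Context {d : measure_display} {Omega : measurableType d} {R : realType}.
Variable P : probability Omega R.

(** The events $X=1$ and $X=0$ are disjoint and their probabilities add up to 1, so the complement
    of their union is null; on the union [X] agrees with the indicator. *)
Lemma bernoulli_ae_indic (p : R) (X : {RV P >-> R}) : is_bernoulli p X ->
  \forall w \ae P, X w = \1_(X @^-1` [set 1]) w.
Proof.
move=> [X1 X0].
have mX r : measurable (X @^-1` [set r]).
  by rewrite -[X in measurable X]setTI; exact: measurable_funP.
exists (~` (X @^-1` [set 1] `|` X @^-1` [set 0])); split.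
- by apply: measurableC; exact: measurableU.
- rewrite probability_setC; last exact: measurableU.
  have -> : P (X @^-1` [set 1] `|` X @^-1` [set 0]) = (p%:E + (1 - p)%:E)%E.
    rewrite -X1 -X0 measureU//.
    by apply/seteqP; split => // w [/= -> /eqP]; rewrite oner_eq0.
  by rewrite -EFinD addrC subrK subrr.
- move=> w /= Xw [] Xw01; apply: Xw; rewrite indicE.
  - by rewrite mem_set.
  - by rewrite Xw01 memNset//= Xw01 => /eqP; rewrite eq_sym oner_eq0.
Qed.

Lemma bernoulli_pair_prob (I : finType) (p : I -> R) (X : I -> {RV P >-> R}) :
  (forall i, is_bernoulli (p i) (X i)) -> mutually_independent X ->
  forall i j, P (X i @^-1` [set 1] `&` X j @^-1` [set 1]) =
    (p i * p j + (i == j)%:R * (p i * (1 - p i)))%:E.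
Proof.
move=> bX indX i j; have [<-|ij] := eqVneq i j.
  by rewrite setIid (bX i).1 mul1r mulrBr mulr1 subrKC.
rewrite mul0r addr0.
(* As $i\ne j$, independence over the two-element set of indices gives exactly two factors. *)
have := indX [set i; j]%SET (fun=> [set 1]) (fun _ _ => measurable_set1 _).
rewrite big_setU1 ?inE//= big_set1 (bX i).1 (bX j).1 -EFinM => <-.
congr (P _); apply/seteqP; split => w /=.
  by move=> [Xi Xj] k /=; rewrite !inE => /orP[]/eqP->.
by move=> Xw; split; apply: Xw; rewrite /= !inE eqxx ?orbT.
Qed.

End bernoulli.

Theorem theorem2p9 (R : realType)
    (d : measure_display) (V : measurableType d)
    (mu : {measure set V -> \bar R})
    (d' : measure_display) (Omega : measurableType d')
    (P : probability Omega R)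
    (N : nat) (K : 'I_N -> L2 mu) (g : 'I_N -> R) (p : 'I_N -> R)
    (p01 : forall j, 0 <= p j <= 1)
    (eps : 'I_N -> {RV P >-> R})
    (eps_bernoulli : forall j, is_bernoulli (p j) (eps j))
    (eps_indep : mutually_independent eps)
    (calE : Omega -> L2 mu)
    (calE_def : forall w, calE w = \sum_(j < N) (eps j w * g j) *: K j) :
  'E_P[fun w => (L2norm (calE w) ^+ 2)%R]%E =
  (L2norm (\sum_(j < N) (p j * g j) *: K j) ^+ 2
   + \sum_(j < N) p j * (1 - p j) * `|g j| ^+ 2 * L2norm (K j) ^+ 2)%:E.
Proof.
pose A j := eps j @^-1` [set 1].
have mA j : measurable (A j).
  by rewrite -[A j]setTI; exact: measurable_funP.
have mAA (ij : 'I_N * 'I_N) : measurable (A ij.1 `&` A ij.2).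
  exact: measurableI.
pose c (ij : 'I_N * 'I_N) := g ij.1 * g ij.2 * L2dot mu (K ij.1) (K ij.2).
have normE w : L2norm (calE w) ^+ 2 =
    \sum_ij c ij * (eps ij.1 w * eps ij.2 w).
  rewrite calE_def L2norm_lincomb_sqr; apply: eq_bigr => ij _.
  by rewrite /c; ring.
rewrite unlock; under eq_integral do rewrite normE.
(* A product of two indicators is the indicator of the intersection, whose integral is a joint
   probability. *)
transitivity (\int[P]_w (\sum_ij c ij * \1_(A ij.1 `&` A ij.2) w)%:E)%E.
  apply: ae_eq_integral => //.
  - apply/measurable_EFinP/measurable_sum => ij.
    by apply: measurable_funM => //; exact: measurable_funM.
  - apply/measurable_EFinP/measurable_sum => ij.
    by apply: measurable_funM => //; exact: measurable_indic.
  - have : \forall w \ae P, forall j, eps j w = \1_(A j) w.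
      (* Finitely many null sets are discarded at once. *)
      apply: filter_forall => j; exact: bernoulli_ae_indic (eps_bernoulli j).
    apply: filterS => w epsA _; congr EFin; apply: eq_bigr => ij _.
    by rewrite !epsA indicI.
rewrite integral_lincomb; last first.
  by move=> ij; exact: integrable_indic.
congr EFin; rewrite L2norm_lincomb_sqr.
have intA (ij : 'I_N * 'I_N) : \int[P]_w \1_(A ij.1 `&` A ij.2) w =
    p ij.1 * p ij.2 + (ij.1 == ij.2)%:R * (p ij.1 * (1 - p ij.1)).
  rewrite /Rintegral integral_indic// setIT.
  by have /(congr1 fine) := bernoulli_pair_prob P _ p eps eps_bernoulli eps_indep
    ij.1 ij.2.
(* The terms $p_ip_j$ rebuild the squared norm of the mean; the diagonal corrections give the
   variance sum. *)
under eq_bigr do rewrite intA mulrDr.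
rewrite big_split/=; congr (_ + _).
  by apply: eq_bigr => ij _; rewrite /c; ring.
(* Back to a double sum, where for each [i] only $j=i$ survives. *)
rewrite -(pair_bigA _ (fun i j => c (i, j) *
  ((i == j)%:R * (p i * (1 - p i)))))/=.
apply: eq_bigr => i _; rewrite (bigD1 i)//= big1 => [|j ji].
  by rewrite eqxx addr0 L2norm_sqr real_normK ?num_real// /c/=; ring.
by rewrite eq_sym (negbTE ji) mul0r mulr0.
Qed.
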